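(* Let $\mathcal{C}$ be a strict monoidal category and let $T$ be a strong twine on $\mathcal{C}$ (i.e. $(\mathcal{C},T)$ is strongly entwined). Then $T$ is a twine on $\mathcal{C}$ (i.e. $(\mathcal{C},T)$ is entwined).
   Context: All monoidal categories are strict, with unit object $I$; juxtaposition of morphisms denotes composition. A strong twine on $\mathcal{C}$ is a natural isomorphism $T_{U,V}:U\otimes V\to U\otimes V$ (natural in both variables) such that for all objects $U,V,W$: 1. $T_{I,I}=\mathrm{id}_I$; 2. $(T_{U,V}\otimes \mathrm{id}_W)T_{U\otimes V,W}=(\mathrm{id}_U\otimes T_{V,W})T_{U,V\otimes W}$; 3. $(T_{U,V}\otimes \mathrm{id}_W)(\mathrm{id}_U\otimes T_{V,W})=(\mathrm{id}_U\otimes T_{V,W})(T_{U,V}\otimes \mathrm{id}_W)$. A twine on $\mathcal{C}$ is a natural isomorphism $D_{X,Y}:X\otimes Y\to X\otimes Y$ such that for all objects $X,Y,Z,W$: 1. $D_{I,I}=\mathrm{id}_I$; 2. $(D_{X,Y}\otimes \mathrm{id}_Z)D_{X\otimes Y,Z}=(\mathrm{id}_X\otimes D_{Y,Z})D_{X,Y\otimes Z}$; 3. $(D_{X\otimes Y,Z}\otimes \mathrm{id}_W)(\mathrm{id}_X\otimes D_{Y,Z}^{-1}\otimes \mathrm{id}_W)(\mathrm{id}_X\otimes D_{Y,Z\otimes W})=(\mathrm{id}_X\otimes D_{Y,Z\otimes W})(\mathrm{id}_X\otimes D_{Y,Z}^{-1}\otimes \mathrm{id}_W)(D_{X\otimes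 Y,Z}\otimes \mathrm{id}_W)$. *)

(* Defs.v *)
Set Implicit Arguments.
Unset Strict Implicit.
Unset Printing Implicit Defensive.

Record category : Type := Category {
  ob :> Type;
  hom : ob -> ob -> Type;
  idm : forall X : ob, hom X X;
  comp : forall X Y Z : ob, hom Y Z -> hom X Y -> hom X Z;
  comp_idl : forall (X Y : ob) (f : hom X Y), comp (idm Y) f = f;
  comp_idr : forall (X Y : ob) (f : hom X Y), comp f (idm X) = f;
  comp_assoc : forall (X Y Z W : ob)
      (h : hom Z W) (g : hom Y Z) (f : hom X Y),
    comp h (comp g f) = comp (comp h g) f
}.

Arguments hom {c} X Y.
Arguments idm {c} X.
Arguments comp {c X Y Z} g f.

(* Composition is in the classical order: g ∘ f is "g after f". *)
Notation "g ∘ f" := (comp g f) (at level 45, left associativity).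

Definition prod_category (C D : category) : category.
Proof.
refine (@Category (ob C * ob D)
  (fun X Y => (hom (fst X) (fst Y) * hom (snd X) (snd Y))%type)
  (fun X => (idm (fst X), idm (snd X)))
  (fun X Y Z g f => (fst g ∘ fst f, snd g ∘ snd f)) _ _ _).
- intros X Y [f1 f2]; simpl; now rewrite !comp_idl.
- intros X Y [f1 f2]; simpl; now rewrite !comp_idr.
- intros X Y Z W h g f; simpl; now rewrite !comp_assoc.
Defined.

Record functor (C D : category) : Type := Functor {
  fobj :> C -> D;
  fmap : forall X Y : C, hom X Y -> hom (fobj X) (fobj Y);
  fmap_id : forall X : C, fmap (idm X) = idm (fobj X);
  fmap_comp : forall (X Y Z : C) (g : hom Y Z) (f : hom X Y),
    fmap (g ∘ f) = fmap g ∘ fmap f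
}.

Arguments fmap {C D} F {X Y} f : rename.

Record nat_iso (C D : category) (F G : functor C D) : Type := NatIso {
  nat_comp :> forall X : C, hom (F X) (G X);
  nat_inv : forall X : C, hom (G X) (F X);
  nat_compK : forall X : C, nat_inv X ∘ nat_comp X = idm (F X);
  nat_invK : forall X : C, nat_comp X ∘ nat_inv X = idm (G X);
  naturality : forall (X Y : C) (f : hom X Y),
    nat_comp Y ∘ fmap F f = fmap G f ∘ nat_comp X
}.

(* Strictness makes (X ⊗ Y) ⊗ Z and X ⊗ (Y ⊗ Z) propositionally, not
   definitionally, equal; [hcast] transports a morphism along such
   equalities of its source and target. *)
Definition hcast (C : category) (X X' Y Y' : C) (eX : X = X') (eY : Y = Y')
    (f : hom X Y) : hom X' Y' :=
  match eX in _ = A, eY in _ = B return hom A B with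
  | eq_refl, eq_refl => f
  end.

Definition ecast (C : category) (X X' : C) (e : X = X') (f : hom X X) :
  hom X' X' := hcast e e f.

Definition tensor_ob (C : category) (F : functor (prod_category C C) C)
    (X Y : C) : C := F (X, Y).

Definition tensor_hom (C : category) (F : functor (prod_category C C) C)
    (X X' Y Y' : C) (f : hom X X') (g : hom Y Y') :
    hom (tensor_ob F X Y) (tensor_ob F X' Y') :=
  @fmap (prod_category C C) C F (X, Y) (X', Y') (f, g).

Record strict_monoidal_category : Type := StrictMonoidalCategory {
  smc_cat :> category;
  tensor : functor (prod_category smc_cat smc_cat) smc_cat;
  unit_ob : smc_cat;
  tensorA : forall X Y Z : smc_cat,
    tensor_ob tensor (tensor_ob tensor X Y) Z
    = tensor_ob tensor X (tensor_ob tensor Y Z);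
  tensor1l : forall X : smc_cat, tensor_ob tensor unit_ob X = X;
  tensor1r : forall X : smc_cat, tensor_ob tensor X unit_ob = X;
  tensor_homA : forall (X X' Y Y' Z Z' : smc_cat)
      (f : hom X X') (g : hom Y Y') (h : hom Z Z'),
    hcast (tensorA X Y Z) (tensorA X' Y' Z')
      (tensor_hom tensor (tensor_hom tensor f g) h)
    = tensor_hom tensor f (tensor_hom tensor g h);
  tensor_hom1l : forall (X X' : smc_cat) (f : hom X X'),
    hcast (tensor1l X) (tensor1l X') (tensor_hom tensor (idm unit_ob) f) = f;
  tensor_hom1r : forall (X X' : smc_cat) (f : hom X X'),
    hcast (tensor1r X) (tensor1r X') (tensor_hom tensor f (idm unit_ob)) = f
}.

Arguments unit_ob {s}.
Arguments tensorA {s} X Y Z.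
Arguments tensor1l {s} X.
Arguments tensor1r {s} X.

Notation "X ⊗ Y" := (tensor_ob (tensor _) X Y)
  (at level 40, left associativity).
Notation "f ⊗₁ g" := (tensor_hom (tensor _) f g)
  (at level 40, left associativity).

(* Natural isomorphisms U ⊗ V -> U ⊗ V, natural in both variables. *)
Definition tensor_auto (C : strict_monoidal_category) : Type :=
  nat_iso (tensor C) (tensor C).

Definition auto_at (C : strict_monoidal_category) (T : tensor_auto C)
    (U V : C) : hom (U ⊗ V) (U ⊗ V) := nat_comp T (U, V).

Definition auto_inv_at (C : strict_monoidal_category) (T : tensor_auto C)
    (U V : C) : hom (U ⊗ V) (U ⊗ V) := nat_inv T (U, V).

(* In the axioms below every factor is transported to the fully
   right-bracketed tensor product. *)

Definition tensorA_mid (C : strict_monoidal_category) (X Y Z W : C) :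
    X ⊗ ((Y ⊗ Z) ⊗ W) = X ⊗ (Y ⊗ (Z ⊗ W)) :=
  f_equal (fun A : C => X ⊗ A) (tensorA Y Z W).

Definition tensorA4 (C : strict_monoidal_category) (X Y Z W : C) :
    ((X ⊗ Y) ⊗ Z) ⊗ W = X ⊗ (Y ⊗ (Z ⊗ W)) :=
  eq_trans (tensorA (X ⊗ Y) Z W) (tensorA X Y (Z ⊗ W)).

Definition twine_unit (C : strict_monoidal_category) (T : tensor_auto C) :
    Prop :=
  ecast (tensor1l unit_ob) (auto_at T unit_ob unit_ob) = idm unit_ob.

Definition twine_assoc (C : strict_monoidal_category) (T : tensor_auto C) :
    Prop :=
  forall U V W : C,
    ecast (tensorA U V W) ((auto_at T U V ⊗₁ idm W) ∘ auto_at T (U ⊗ V) W)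
    = (idm U ⊗₁ auto_at T V W) ∘ auto_at T U (V ⊗ W).

Record strong_twine (C : strict_monoidal_category) (T : tensor_auto C) :
    Prop := StrongTwine {
  strong_twine_unit : twine_unit T;
  strong_twine_assoc : twine_assoc T;
  strong_twine_comm : forall U V W : C,
    let T_UV := ecast (tensorA U V W) (auto_at T U V ⊗₁ idm W) in
    let T_VW := idm U ⊗₁ auto_at T V W in
    T_UV ∘ T_VW = T_VW ∘ T_UV
}.

Record twine (C : strict_monoidal_category) (D : tensor_auto C) :
    Prop := Twine {
  twine_unitP : twine_unit D;
  twine_assocP : twine_assoc D;
  twine_comm : forall X Y Z W : C,
    let D_XY_Z := ecast (tensorA4 X Y Z W) (auto_at D (X ⊗ Y) Z ⊗₁ idm W) in
    let D_YZ_inv := ecast (tensorA_mid X Y Z W)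
                      (idm X ⊗₁ (auto_inv_at D Y Z ⊗₁ idm W)) in
    let D_Y_ZW := idm X ⊗₁ auto_at D Y (Z ⊗ W) in
    (D_XY_Z ∘ D_YZ_inv) ∘ D_Y_ZW = (D_Y_ZW ∘ D_YZ_inv) ∘ D_XY_Z
}.

(* Main.v *)
(* On X ⊗ Y ⊗ Z ⊗ W put
     p = T_{X,Y},  q = T_{Y,Z},  r = T_{Z,W},
     A = T_{X⊗Y,Z},  E = T_{Y,Z⊗W},  R = T_{X,Y⊗Z},  S = T_{Y⊗Z,W},
   each tensored with identities.  Axiom (2) gives p A = q R and r E = q S.
   Axiom (3) at (Z, W) grouped, at (X, Y) grouped and at (Y, Z) grouped makes p
   commute with E, r with A, and R with S; ungrouped it makes q commute with p
   and r.  Hence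
     r p A q^-1 E = (p A) q^-1 (r E) = q R S = q S R = (r E) q^-1 (p A)
                  = r p E q^-1 A,
   and r p can be cancelled. *)

Require Import Defs.
From Stdlib Require Import ProofIrrelevance.

Set Implicit Arguments.
Unset Strict Implicit.
Unset Printing Implicit Defensive.

Section Category.

Variable C : category.

Lemma ecast_comp (X X' : C) (e : X = X') (f g : hom X X) :
  ecast e (f ∘ g) = ecast e f ∘ ecast e g.
Proof. now destruct e. Qed.

Lemma ecast_id (X X' : C) (e : X = X') : ecast e (idm X) = idm X'.
Proof. now destruct e. Qed.

Lemma ecast_trans (X Y Z : C) (e : X = Y) (e' : Y = Z) (f : hom X X) :
  ecast (eq_trans e e') f = ecast e' (ecast e f).
Proof. now destruct e'. Qed.

(** Proof irrelevance takes the place of coherence: two rebracketings with the same ends transport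
    alike. *)
Lemma ecast_irrelevant (X Y : C) (e e' : X = Y) (f : hom X X) :
  ecast e f = ecast e' f.
Proof. now rewrite (proof_irrelevance _ e e'). Qed.

(** Multiply [f ∘ g = g ∘ f] by [f'] on both sides. *)
Lemma commute_inv (X : C) (f f' g : hom X X) :
  f' ∘ f = idm X -> f ∘ f' = idm X -> f ∘ g = g ∘ f -> f' ∘ g = g ∘ f'.
Proof.
intros f'f ff' fg.
now rewrite <- (comp_idr (f' ∘ g)), <- ff', comp_assoc, <- (comp_assoc f' g f),
  <- fg, comp_assoc, f'f, comp_idl.
Qed.

Lemma left_cancel (X : C) (f' f g h : hom X X) :
  f' ∘ f = idm X -> f ∘ g = f ∘ h -> g = h.
Proof.
intros f'f fg.
now rewrite <- (comp_idl g), <- f'f, <- comp_assoc, fg, comp_assoc, f'f,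
  comp_idl.
Qed.

(** The algebraic core, isolated in the endomorphism monoid of a single object so that no transport
    enters it. *)
Lemma exchange_across_inverse (P : C) (p p' r r' q q' A E R S : hom P P) :
  p' ∘ p = idm P -> r' ∘ r = idm P -> q' ∘ q = idm P -> q ∘ q' = idm P ->
  p ∘ A = q ∘ R -> r ∘ E = q ∘ S ->
  p ∘ r = r ∘ p -> A ∘ r = r ∘ A -> q ∘ r = r ∘ q ->
  p ∘ E = E ∘ p -> p ∘ q = q ∘ p -> R ∘ S = S ∘ R ->
  (A ∘ q') ∘ E = (E ∘ q') ∘ A.
Proof.
intros p'p r'r q'q qq' pA rE pr Ar qr pE pq RS.
assert (q'r := commute_inv q'q qq' qr).
assert (q'p := commute_inv q'q qq' (eq_sym pq)).
apply (left_cancel p'p), (left_cancel r'r).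
(* Here [r] moves right past [p], [A] and [q'] until it meets [E]. *)
transitivity ((p ∘ A) ∘ q' ∘ (r ∘ E)).
  now rewrite !comp_assoc, <- pr, <- (comp_assoc p r A), <- Ar, comp_assoc,
    <- (comp_assoc (p ∘ A) r q'), <- q'r, comp_assoc.
(* Both sides collapse through [q' ∘ q], to [q ∘ R ∘ S] and [q ∘ S ∘ R]. *)
transitivity ((r ∘ E) ∘ q' ∘ (p ∘ A)).
  rewrite pA, rE.
  now rewrite <- !comp_assoc, (comp_assoc q' q S), (comp_assoc q' q R), q'q,
    !comp_idl, RS.
now rewrite !comp_assoc, <- (comp_assoc (r ∘ E) q' p), q'p, comp_assoc,
  <- (comp_assoc r E p), <- pE, comp_assoc.
Qed.

End Category.

Section StrictMonoidal.

Variable C : strict_monoidal_category.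

Lemma tensor_hom_comp (X X' X'' Y Y' Y'' : C)
    (g : hom X' X'') (f : hom X X') (g' : hom Y' Y'') (f' : hom Y Y') :
  (g ∘ f) ⊗₁ (g' ∘ f') = (g ⊗₁ g') ∘ (f ⊗₁ f').
Proof.
exact (@fmap_comp _ _ (tensor C) (X, Y) (X', Y') (X'', Y'') (g, g') (f, f')).
Qed.

Lemma tensor_hom_id (X Y : C) : idm X ⊗₁ idm Y = idm (X ⊗ Y).
Proof. exact (@fmap_id _ _ (tensor C) (X, Y)). Qed.

Lemma whisker_left_comp (X Y : C) (g f : hom Y Y) :
  idm X ⊗₁ (g ∘ f) = (idm X ⊗₁ g) ∘ (idm X ⊗₁ f).
Proof. now rewrite <- tensor_hom_comp, comp_idl. Qed.

Lemma whisker_right_comp (X Y : C) (g f : hom X X) :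
  (g ∘ f) ⊗₁ idm Y = (g ⊗₁ idm Y) ∘ (f ⊗₁ idm Y).
Proof. now rewrite <- tensor_hom_comp, comp_idl. Qed.

Lemma whisker_exchange (X Y : C) (f : hom X X) (g : hom Y Y) :
  (f ⊗₁ idm Y) ∘ (idm X ⊗₁ g) = (idm X ⊗₁ g) ∘ (f ⊗₁ idm Y).
Proof. now rewrite <- !tensor_hom_comp, !comp_idl, !comp_idr. Qed.

Lemma whisker_left_ecast (X Y Y' : C) (e : Y = Y') (f : hom Y Y) :
  idm X ⊗₁ ecast e f = ecast (f_equal (fun A : C => X ⊗ A) e) (idm X ⊗₁ f).
Proof. now destruct e. Qed.

Lemma whisker_right_ecast (X X' Y : C) (e : X = X') (f : hom X X) :
  ecast e f ⊗₁ idm Y = ecast (f_equal (fun A : C => A ⊗ Y) e) (f ⊗₁ idm Y).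
Proof. now destruct e. Qed.

Lemma ecast_tensorA (X Y Z : C) (f : hom X X) (g : hom Y Y) (h : hom Z Z) :
  ecast (tensorA X Y Z) ((f ⊗₁ g) ⊗₁ h) = f ⊗₁ (g ⊗₁ h).
Proof. apply tensor_homA. Qed.

Lemma ecast_tensorA_right (X Y Z : C) (f : hom X X) :
  ecast (tensorA X Y Z) ((f ⊗₁ idm Y) ⊗₁ idm Z) = f ⊗₁ idm (Y ⊗ Z).
Proof. now rewrite ecast_tensorA, tensor_hom_id. Qed.

Lemma ecast_tensorA_left (X Y Z : C) (f : hom Z Z) :
  ecast (tensorA X Y Z) (idm (X ⊗ Y) ⊗₁ f) = idm X ⊗₁ (idm Y ⊗₁ f).
Proof. now rewrite <- tensor_hom_id, ecast_tensorA. Qed.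

(** The two sides follow the two paths of the associativity pentagon. The three-step path lets an
    identity on X, Y, Z be tensored with [idm W]. *)
Lemma ecast_pentagon (X Y Z W : C) (f : hom ((X ⊗ Y) ⊗ Z) ((X ⊗ Y) ⊗ Z)) :
  ecast (tensorA4 X Y Z W) (f ⊗₁ idm W)
  = ecast (tensorA_mid X Y Z W)
      (ecast (tensorA X (Y ⊗ Z) W) (ecast (tensorA X Y Z) f ⊗₁ idm W)).
Proof.
rewrite whisker_right_ecast, <- !ecast_trans; apply ecast_irrelevant.
Qed.

(** Lets [p] be read with Z and W grouped or separate: [tensorA4] passes through
    [(X ⊗ Y) ⊗ (Z ⊗ W)]. *)
Lemma ecast_tensorA4_right (X Y Z W : C) (f : hom (X ⊗ Y) (X ⊗ Y)) :
  ecast (tensorA4 X Y Z W) ((f ⊗₁ idm Z) ⊗₁ idm W)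
  = ecast (tensorA X Y (Z ⊗ W)) (f ⊗₁ idm (Z ⊗ W)).
Proof. now unfold tensorA4; rewrite ecast_trans, ecast_tensorA_right. Qed.

Lemma auto_invK (T : tensor_auto C) (X Y : C) :
  auto_inv_at T X Y ∘ auto_at T X Y = idm (X ⊗ Y).
Proof. exact (nat_compK T (X, Y)). Qed.

Lemma autoK_inv (T : tensor_auto C) (X Y : C) :
  auto_at T X Y ∘ auto_inv_at T X Y = idm (X ⊗ Y).
Proof. exact (nat_invK T (X, Y)). Qed.

End StrictMonoidal.

Theorem proposition2p8 (C : strict_monoidal_category) (T : tensor_auto C) :
  strong_twine T -> twine T.
Proof.
intros [T1 TA TC]; split; [exact T1 | exact TA |].
intros X Y Z W; cbv zeta.
(* The goal itself determines [A], [E] and [q']; the other factors are supplied on the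
   right-bracketed product. *)
apply (exchange_across_inverse
  (p := ecast (tensorA X Y (Z ⊗ W)) (auto_at T X Y ⊗₁ idm (Z ⊗ W)))
  (p' := ecast (tensorA X Y (Z ⊗ W)) (auto_inv_at T X Y ⊗₁ idm (Z ⊗ W)))
  (r := idm X ⊗₁ (idm Y ⊗₁ auto_at T Z W))
  (r' := idm X ⊗₁ (idm Y ⊗₁ auto_inv_at T Z W))
  (q := ecast (tensorA_mid X Y Z W) (idm X ⊗₁ (auto_at T Y Z ⊗₁ idm W)))
  (R := ecast (tensorA_mid X Y Z W)
          (ecast (tensorA X (Y ⊗ Z) W) (auto_at T X (Y ⊗ Z) ⊗₁ idm W)))
  (S := ecast (tensorA_mid X Y Z W) (idm X ⊗₁ auto_at T (Y ⊗ Z) W))).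
- now rewrite <- ecast_comp, <- whisker_right_comp, auto_invK, tensor_hom_id,
    ecast_id.
- now rewrite <- !whisker_left_comp, auto_invK, !tensor_hom_id.
- now rewrite <- ecast_comp, <- whisker_left_comp, <- whisker_right_comp,
    auto_invK, !tensor_hom_id, ecast_id.
- now rewrite <- ecast_comp, <- whisker_left_comp, <- whisker_right_comp,
    autoK_inv, !tensor_hom_id, ecast_id.
(* [p ∘ A = q ∘ R]: axiom (2) at X, Y, Z, tensored with [idm W]. *)
- rewrite <- ecast_tensorA4_right, <- ecast_comp, <- whisker_right_comp.
  now rewrite ecast_pentagon, (TA X Y Z), whisker_right_comp, !ecast_comp,
    ecast_tensorA.
- now rewrite <- whisker_left_comp, <- (TA Y Z W), whisker_left_ecast,
    whisker_left_comp, ecast_comp.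
(* [p] and [r] act on disjoint factors, so the interchange law suffices. *)
- now rewrite <- ecast_tensorA_left, <- !ecast_comp, whisker_exchange.
- unfold tensorA4; rewrite ecast_trans, <- ecast_tensorA_left, <- !ecast_comp.
  now rewrite (TC (X ⊗ Y) Z W).
- unfold tensorA_mid; rewrite <- whisker_left_ecast, <- !whisker_left_comp.
  now rewrite (TC Y Z W).
- exact (TC X Y (Z ⊗ W)).
(* [p ∘ q = q ∘ p]: axiom (3) at X, Y, Z, tensored with [idm W] after both factors are moved to the
   three-step path. *)
- rewrite <- ecast_tensorA4_right, <- ecast_tensorA, !ecast_pentagon.
  now rewrite <- !ecast_comp, <- !whisker_right_comp, (TC X Y Z).
- now rewrite <- !ecast_comp, (TC X (Y ⊗ Z) W).
Qed.
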